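(* Let $\mathcal{A}_0=\langle A_0,R_0\rangle$ and $\mathcal{A}_1=\langle A_1,R_1\rangle$ be almost bounded structures. If $\mathcal{A}_0\preceq\mathcal{A}_1$, then $\mathcal{A}_0^{\mathfrak{ue}}\preceq\mathcal{A}_1^{\mathfrak{ue}}$.
   Context: All structures are of the form $\mathcal{A}=\langle A,R\rangle$ with a single binary relation $R\subseteq A\times A$. $\mathcal{A}$ is bounded if there is a finite number that bounds the in-degree and out-degree of every node of $\mathcal{A}$. $\mathcal{A}$ is almost bounded if, except for finitely many nodes with infinite degree (infinitely many $R$-successors or infinitely many $R$-predecessors), $\mathcal{A}$ is bounded; i.e. only finitely many nodes have infinite degree and there is a finite bound on the in- and out-degrees of all the other nodes. The ultrafilter extension of $\mathcal{A}$ is $\mathcal{A}^{\mathfrak{ue}}=\langle \mathrm{Uf}(A),R^{\mathfrak{ue}}\rangle$, where $\mathrm{Uf}(A)$ is the set of all ultrafilters over $A$ and $R^{\mathfrak{ue}}(u,v)$ holds iff $\{R[X]:X\in u\}\subseteq v$ (equivalently $\{\langle R\rangle(X):X\in v\}\subseteq u$), with $R[X]=\{s:(\exists w\in X)\,R(w,s)\}$ and $\langle R\rangle(X)=\{w:(\exists s\in X)\,R(w,s)\}$. $\preceq$ denotes elementary substructure. For $A_0\subseteq A_1$, $\mathrm{Uf}(A_0)$ is regarded as a subset of $\mathrm{Uf}(A_1)$ through the canonical injection $u\mapsto\{X\subseteq A_1: X\cap A_0\in u\}$. *)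

(* Defs.v *)
From mathcomp Require Import all_boot.
From mathcomp Require Import all_classical.

Set Implicit Arguments.
Unset Strict Implicit.
Unset Printing Implicit Defensive.

Local Open Scope classical_set_scope.

(** A structure with one binary relation is given by a type [A] and a relation
    [R : A -> A -> Prop]. *)

Section Degree.
Variables (A : Type) (R : A -> A -> Prop).

Definition succs (x : A) : set A := [set y | R x y].
Definition preds (x : A) : set A := [set y | R y x].

Definition infinite_degree : set A :=
  [set x | infinite_set (succs x) \/ infinite_set (preds x)].

Definition almost_bounded : Prop :=
  finite_set infinite_degree /\
  exists n : nat, forall x, ~ infinite_degree x ->
    (succs x #<= `I_n)%card /\ (preds x #<= `I_n)%card.

End Degree.

(** First-order formulas over one binary predicate, with equality.  The free
    variables of [phi : formula n] are among ['I_n]; [Ex phi] binds variable [0]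
    of [phi] and variable [i.+1] of [phi] is variable [i] of [Ex phi].  Indexing
    formulas by their context keeps the notion meaningful on an empty domain. *)

Inductive formula : nat -> Type :=
| Equ n of 'I_n & 'I_n : formula n
| Rel n of 'I_n & 'I_n : formula n
| Neg n of formula n : formula n
| And n of formula n & formula n : formula n
| Ex n of formula n.+1 : formula n.

Definition extend (A : Type) n (x : A) (e : 'I_n -> A) : 'I_n.+1 -> A :=
  fun i => if unlift ord0 i is Some j then e j else x.

Fixpoint sat (A : Type) (R : A -> A -> Prop) n (phi : formula n) :
    ('I_n -> A) -> Prop :=
  match phi in formula n return ('I_n -> A) -> Prop with
  | Equ _ i j => fun e => e i = e j
  | Rel _ i j => fun e => R (e i) (e j)
  | Neg _ p => fun e => ~ sat R p e
  | And _ p q => fun e => sat R p e /\ sat R q e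
  | Ex _ p => fun e => exists x, sat R p (extend x e)
  end.

(** [elementary R0 R1 f]: [(A0, R0)] is an elementary substructure of [(A1, R1)]
    when [A0] is regarded as a subset of [A1] through [f].  Taking [phi] atomic,
    this includes that [f] is injective and that [R0] is induced by [R1]. *)

Definition elementary (A0 A1 : Type) (R0 : A0 -> A0 -> Prop)
    (R1 : A1 -> A1 -> Prop) (f : A0 -> A1) : Prop :=
  forall n (phi : formula n) (e : 'I_n -> A0),
    sat R0 phi e <-> sat R1 phi (f \o e).

Record Uf (A : Type) : Type := MkUf {
  uf_sets :> set_system A;
  uf_ultra : UltraFilter uf_sets
}.

Definition rel_image (A : Type) (R : A -> A -> Prop) (X : set A) : set A :=
  [set s | exists2 w, X w & R w s].

Definition ue (A : Type) (R : A -> A -> Prop) (u v : Uf A) : Prop :=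
  [set rel_image R X | X in (u : set_system A)] `<=` (v : set_system A).

Lemma uf_incl_ultra (A1 : Type) (A0 : set A1) (u : Uf A0) :
  UltraFilter [set X : set A1 | (u : set_system A0) (set_val @^-1` X)].
Proof.
case: u => F FU /=.
have PF : ProperFilter [set X : set A1 | F (set_val @^-1` X)].
  split; first by rewrite /= preimage_set0; exact: filter_not_empty.
  split=> /=.
  - by rewrite preimage_setT; exact: filterT.
  - by move=> X Y; rewrite /= preimage_setI => FX FY; exact: filterI.
  - by move=> X Y XY; apply: filterS => a; exact: XY.
split=> // G GP FG; apply/seteqP; split; last exact: FG.
move=> X GX; have [//|/= FnX] := in_ultra_setVsetC (set_val @^-1` X) FU.
have GnX : G (~` X) by apply: FG; rewrite /= preimage_setC.
by case: (@filter_not_empty _ G GP); rewrite -(setICr X); exact: filterI.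
Qed.

(** The preimage of [X] under [set_val] is [X] intersected with [A0], as a
    subset of [A0]. *)
Definition uf_incl (A1 : Type) (A0 : set A1) (u : Uf A0) : Uf A1 :=
  MkUf (uf_incl_ultra u).

(* Main.v *)
From Stdlib Require List.
Require Import Defs.
From mathcomp Require Import all_boot.
From mathcomp Require Import all_classical.

(** The proof is the Tarski-Vaught test: given ultrafilters [e i] over [A0] and an
    ultrafilter [u] over [A1], there must be an ultrafilter [v] over [A0] that
    satisfies the same formulas as [u] with the parameters [e i].  If [A0] belongs
    to [u], then [u] itself comes from [A0].  Otherwise [u] lives on the complement
    of [A0], and an automorphism of the ultrafilter extension of [A1] is constructed
    that fixes the [e i] and sends [u] into the ultrafilters over [A0].

    Let [C] be the finite set of points of [A1] of infinite degree.  By elementarity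
    [C] is contained in [A0] ([infinite_degree_base]) and no edge that avoids [C]
    leaves [A0] ([base_closed]).  The edges that avoid [C] have bounded degree, so
    they are a union of finitely many partial injections [f l] ([edge_coloring]).
    This controls the ultrafilter extension away from [C]: a neighbour of [p] is
    the image of [p] under one of the [f l] ([ue_step]), so the component of [p]
    consists of its images under words in the [f l], and equality and edges between
    two such images hold exactly when they hold at almost every point ([umap_word_eq],
    [ue_word]).  The combinatorial core is that two maps that are injective on a large
    set and have the same image ultrafilter agree almost everywhere ([umap_eq_ae]).

    The component of [u], together with its edges to and from [C], is therefore
    described by countably many first-order patterns that hold at almost all points
    of [u]: equations and edges between the points [word f w d] and the elements of
    [C], and the statement that the neighbours of [word f w d] are the expected ones.
    Finitely many of them are realized outside [A0], hence by elementarity they are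
    realized infinitely often inside [A0].  Realizations in [A0] of more and more
    patterns, followed along an ultrafilter on the indices, converge to an
    ultrafilter [v] over [A0] and to an isomorphism from the component of [u] to
    that of [v] ([lim_eq], [lim_ue], [component_next], [copy_next]).  The components
    of the [e i] are countable, while the index ultrafilter can be chosen in
    continuum many ways, so [v] can be kept out of these components
    ([branch_escape]).  The automorphism exchanges the components of [u] and [v]
    and is the identity elsewhere ([sat_swap]). *)

Set Implicit Arguments.
Unset Strict Implicit.
Unset Printing Implicit Defensive.

Local Open Scope classical_set_scope.

(** * Ultrafilters and their images *)

Definition uf_mem (A : Type) (p : Uf A) (X : set A) : Prop := uf_sets p X.
Arguments uf_mem {A} p X /.
Coercion uf_mem : Uf >-> Funclass.

Section UltrafilterBasics.
Variables (A : Type) (p : Uf A).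

Lemma uf_proper : ProperFilter (uf_sets p).
Proof. by have := uf_ultra p; case. Qed.

Lemma uf_setT : p setT.
Proof. by have P := uf_proper; exact: filterT. Qed.

Lemma uf_set0 : ~ p set0.
Proof. by have P := uf_proper; exact: filter_not_empty. Qed.

Lemma uf_subset (X Y : set A) : X `<=` Y -> p X -> p Y.
Proof. by have P := uf_proper; exact: filterS. Qed.

Lemma uf_setI (X Y : set A) : p X -> p Y -> p (X `&` Y).
Proof. by have P := uf_proper; exact: filterI. Qed.

Lemma uf_setC (X : set A) : p (~` X) <-> ~ p X.
Proof.
split=> [pNX pX|npX].
  by apply: uf_set0; rewrite -(setICr X); exact: uf_setI.
by have [] := in_ultra_setVsetC X (uf_ultra p).
Qed.

Lemma uf_exists (L : finType) (P : L -> set A) :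
  p [set x | exists l, P l x] -> exists l, p (P l).
Proof.
move=> pE; apply: contrapT => /forallNP H.
have F := uf_proper.
have pA : p [set x | forall l, (~` P l) x].
  by apply: filter_forall => l; apply/uf_setC; exact: H.
apply: uf_set0; apply: uf_subset (uf_setI pE pA).
by move=> x [[l Pl] /(_ l)].
Qed.

Lemma uf_forall (L : finType) (P : L -> set A) :
  (forall l, p (P l)) -> p [set x | forall l, P l x].
Proof. by have F := uf_proper; exact: filter_forall. Qed.

End UltrafilterBasics.

Lemma uf_forall_in (A : Type) (p : Uf A) (K : eqType) (s : seq K)
    (X : K -> set A) :
  (forall k, k \in s -> p (X k)) -> p [set x | forall k, k \in s -> X k x].
Proof.
elim: s => [_|k s IH pX]; first by apply: uf_subset (@uf_setT _ p).
have ps : p [set x | forall k, k \in s -> X k x].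
  by apply: IH => k' k's; apply: pX; rewrite in_cons k's orbT.
apply: uf_subset (uf_setI (pX k (mem_head _ _)) ps) => x [Xk Xs] k'.
by rewrite in_cons => /predU1P[->|/Xs].
Qed.

Lemma uf_eq (A : Type) (p p' : Uf A) : (forall X, p X -> p' X) -> p = p'.
Proof.
move=> sub.
have E : uf_sets p = uf_sets p'.
  apply/seteqP; split=> // X p'X; apply: contrapT => /uf_setC /sub.
  by move=> /uf_setC.
case: p p' E {sub} => [F FU] [G GU] /= E; subst G.
by rewrite (Prop_irrelevance FU GU).
Qed.

Lemma uf_separate (A : Type) (p p' : Uf A) :
  p <> p' -> exists2 X, p X & p' (~` X).
Proof.
move=> neq; apply: contrapT => /forall2NP H; apply: neq; apply: uf_eq => X pX.
have [//|nX] := pselect (p' X).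
by have [] := H X => //; case; apply/uf_setC.
Qed.

Lemma umap_ultra (A B : Type) (s : A -> B) (p : Uf A) :
  UltraFilter [set X : set B | p (s @^-1` X)].
Proof.
split.
  split; first by rewrite /= preimage_set0; exact: uf_set0.
  split=> /=; first by rewrite preimage_setT; exact: uf_setT.
  - by move=> X Y; rewrite /= preimage_setI; exact: uf_setI.
  - by move=> X Y XY; apply: uf_subset => a; exact: XY.
move=> G GP FG; apply/seteqP; split; last exact: FG.
move=> X GX /=; apply: contrapT => /uf_setC pNX.
have GnX : G (~` X) by exact: FG.
by case: (@filter_not_empty _ G GP); rewrite -(setICr X); exact: filterI.
Qed.

Definition umap (A B : Type) (s : A -> B) (p : Uf A) : Uf B :=
  MkUf (umap_ultra s p).

Lemma uf_incl_umap (A1 : Type) (A0 : set A1) (u : Uf A0) :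
  uf_incl u = umap set_val u.
Proof. exact: uf_eq. Qed.

Lemma umap_comp (A B D : Type) (s : A -> B) (t : B -> D) (p : Uf A) :
  umap t (umap s p) = umap (t \o s) p.
Proof. exact: uf_eq. Qed.

Lemma umap_ae (A B : Type) (s t : A -> B) (p : Uf A) :
  p [set x | s x = t x] -> umap s p = umap t p.
Proof.
move=> st; apply: uf_eq => X /= /(uf_setI st).
by apply: uf_subset => x [/= ->].
Qed.

Lemma umap_id (A : Type) (p : Uf A) : umap id p = p.
Proof. exact: uf_eq. Qed.

Definition ae_inj (A B : Type) (p : Uf A) (s : A -> B) :=
  exists2 X, p X & forall x y, X x -> X y -> s x = s y -> x = y.

(** A partial injection that maps an ultrafilter to itself fixes almost every
    point.  Suppose that [s] and [t] differ on a large set, and let [Z] be a maximal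
    set of such points whose images under [s] and [t] are disjoint.  [Z] is not
    large, because the two images would be disjoint large sets of the same
    ultrafilter.  By maximality, each such point [y] outside [Z] has [s y] in
    [t @` Z] or [t y] in [s @` Z]; one of the two holds on a large set, so the common
    image ultrafilter contains [t @` Z] or [s @` Z], and [Z] is large after all. *)
Lemma umap_eq_ae (A B : Type) (s t : A -> B) (p : Uf A) :
  ae_inj p s -> ae_inj p t ->
  umap s p = umap t p -> p [set x | s x = t x].
Proof.
move=> [X pX sX] [X' pX' tX] st; apply: contrapT => /uf_setC pne.
pose Y := X `&` X' `&` [set x | s x <> t x].
have pY : p Y by apply: uf_setI => //; apply: uf_setI.
have YX x : Y x -> X x by case=> [] [].
have YX' x : Y x -> X' x by case=> [] [].
pose P Z := Z `<=` Y /\ forall z z', Z z -> Z z' -> s z <> t z'.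
have [F FP Ftot|Z [[ZY indep] Zmax]] := @Zorn_bigcup A P.
  split=> [x [W /FP[WY _] /WY]//|z z' [W FW Wz] [W' FW' Wz']].
  have [WW'|W'W] := Ftot _ _ FW FW'.
    by apply: (FP _ FW').2 => //; exact: WW'.
  by apply: (FP _ FW).2 => //; exact: W'W.
have cover y : Y y -> [\/ Z y, exists2 z, Z z & s y = t z
                         | exists2 z, Z z & s z = t y].
  move=> Yy; apply: contrapT => N.
  have nZy : ~ Z y by move=> Zy; apply: N; constructor 1.
  apply: (Zmax (y |` Z)).
    by split; [right|move=> /(_ y)/(_ (or_introl erefl))].
  split=> [x [->//|/ZY//]|z z' [->|Zz] [->|Zz']].
  - by case: Yy.
  - by move=> E; apply: N; constructor 2; exists z'.
  - by move=> E; apply: N; constructor 3; exists z.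
  - exact: indep.
have pNZ : ~ p Z.
  move=> pZ.
  have ps : umap s p (s @` Z) by apply: uf_subset pZ => x Zx; exists x.
  have pt : umap s p (t @` Z) by rewrite st; apply: uf_subset pZ => x; exists x.
  apply: (@uf_set0 _ (umap s p)); apply: uf_subset (uf_setI ps pt).
  by move=> _ [[z Zz <-] [z' Zz' /esym]]; exact: indep.
have pB : p [set y | exists b : bool, if b then Y y /\ exists2 z, Z z & s y = t z
                       else Y y /\ exists2 z, Z z & s z = t y].
  move/uf_setC: pNZ => /(uf_setI pY); apply: uf_subset => y [Yy nZy].
  by case: (cover _ Yy) => // H; [exists true|exists false].
have /= [[] pb] := uf_exists pB; apply: pNZ.
  have : umap s p (t @` Z) by apply: uf_subset pb => y [_ [z Zz E]]; exists z.
  rewrite st => /(uf_setI pX'); apply: uf_subset => x [Xx [z Zz tzx]].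
  by rewrite -(tX _ _ (YX' _ (ZY _ Zz)) Xx tzx).
have : umap t p (s @` Z) by apply: uf_subset pb => y [_ [z Zz E]]; exists z.
rewrite -st => /(uf_setI pX); apply: uf_subset => x [Xx [z Zz szx]].
by rewrite -(sX _ _ (YX _ (ZY _ Zz)) Xx szx).
Qed.

Lemma ae_inj_comp (A B D : Type) (s : A -> B) (t : B -> D) (p : Uf A) :
  ae_inj p s -> ae_inj (umap s p) t -> ae_inj p (t \o s).
Proof.
move=> [X pX sX] [Y pY tY]; exists (X `&` s @^-1` Y); first exact: uf_setI.
by move=> x y [Xx Yx] [Xy Yy] /tY-/(_ Yx Yy)/sX; apply.
Qed.

Lemma ueE (A : Type) (R : A -> A -> Prop) (p p' : Uf A) :
  ue R p p' <-> forall X, p X -> p' (rel_image R X).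
Proof.
split=> [H X pX|H _ [X pX <-]]; last exact: H.
by apply: H; exists X.
Qed.

Lemma ue_conv (A : Type) (R : A -> A -> Prop) (p p' : Uf A) :
  ue R p p' -> ue (fun x y => R y x) p' p.
Proof.
move=> /ueE H; apply/ueE => Y p'Y; apply: contrapT => /uf_setC /H.
move=> /(uf_setI p'Y) N; apply: (@uf_set0 _ p'); apply: uf_subset N.
by move=> y [Yy [x nx xy]]; apply: nx; exists y.
Qed.

Lemma ue_umap (I A : Type) (R : A -> A -> Prop) (s t : I -> A) (q : Uf I) :
  q [set i | R (s i) (t i)] -> ue R (umap s q) (umap t q).
Proof.
move=> st; apply/ueE => X /= /(uf_setI st).
by apply: uf_subset => i [/= Ri Xi]; exists (s i).
Qed.

Lemma ue_principal (A : Type) (R : A -> A -> Prop) (c : A) (z p : Uf A) :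
  z [set c] -> ue R z p <-> p [set x | R c x].
Proof.
move=> zc; split=> [/ueE/(_ _ zc)|pc].
  by apply: uf_subset => x [_ ->].
apply/ueE => X zX; apply: uf_subset pc => x Rx; exists c => //.
apply: contrapT => nXc; apply: (@uf_set0 _ z); apply: uf_subset (uf_setI zc zX).
by move=> _ [->].
Qed.

(** * Elementarity and satisfaction *)

Lemma extendE (A : Type) n (x : A) (e : 'I_n -> A) :
  extend x e ord0 = x /\ forall i, extend x e (lift ord0 i) = e i.
Proof. by rewrite /extend unlift_none; split=> // i; rewrite liftK. Qed.

Lemma extend_comp (A B : Type) (h : A -> B) n (x : A) (e : 'I_n -> A) :
  h \o extend x e = extend (h x) (h \o e).
Proof. by apply: funext => i; rewrite /extend /=; case: unlift. Qed.

(** Invariance under isomorphism; as [E] is only a relation, nothing has to be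
    chosen to extend it piecewise. *)
Lemma sat_back_and_forth (A B : Type) (R : A -> A -> Prop)
    (S : B -> B -> Prop) (E : A -> B -> Prop) :
  (forall x, exists y, E x y) -> (forall y, exists x, E x y) ->
  (forall x y x' y', E x y -> E x' y' -> x = x' <-> y = y') ->
  (forall x y x' y', E x y -> E x' y' -> R x x' <-> S y y') ->
  forall n (phi : formula n) e e', (forall i, E (e i) (e' i)) ->
  sat R phi e <-> sat S phi e'.
Proof.
move=> forth back Eeq ERS n phi.
elim: phi => {n} [n i j|n i j|n p IH|n p IHp q IHq|n p IH] e e' ee' /=.
- exact: Eeq.
- exact: ERS.
- by rewrite (IH _ _ ee').
- by rewrite (IHp _ _ ee') (IHq _ _ ee').
have ext x y : E x y -> forall i, E (extend x e i) (extend y e' i).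
  by move=> Exy i; rewrite /extend; case: unlift.
split=> [[x]|[y]].
  by have [y Exy] := forth x; move=> /(IH _ _ (ext _ _ Exy)); exists y.
by have [x Exy] := back y; move=> /(IH _ _ (ext _ _ Exy)); exists x.
Qed.

Lemma tarski_vaught (A B : Type) (R : A -> A -> Prop) (S : B -> B -> Prop)
    (f : A -> B) :
  injective f -> (forall x y, R x y <-> S (f x) (f y)) ->
  (forall n (phi : formula n.+1) (e : 'I_n -> A) y,
     sat S phi (extend y (f \o e)) ->
     exists x, sat S phi (extend (f x) (f \o e))) ->
  elementary R S f.
Proof.
move=> finj fR wit n phi.
elim: phi => {n} [n i j|n i j|n p IH|n p IHp q IHq|n p IH] e /=.
- by split=> [->//|/finj].
- exact: fR.
- by rewrite IH.
- by rewrite IHp IHq.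
split=> [[x /IH]|[y /wit[x]]]; first by rewrite extend_comp; exists (f x).
by rewrite -extend_comp => /IH; exists x.
Qed.

(** [Ex] binds variable [0], which a renaming under it must keep. *)
Definition lift_map n m (g : 'I_n -> 'I_m) : 'I_n.+1 -> 'I_m.+1 :=
  extend ord0 (lift ord0 \o g).

Fixpoint rename n (phi : formula n) : forall m, ('I_n -> 'I_m) -> formula m :=
  match phi in formula n return forall m, ('I_n -> 'I_m) -> formula m with
  | Equ _ i j => fun m g => Equ (g i) (g j)
  | Rel _ i j => fun m g => Rel (g i) (g j)
  | Neg _ p => fun m g => Neg (rename p g)
  | And _ p q => fun m g => And (rename p g) (rename q g)
  | Ex _ p => fun m g => Ex (rename p (lift_map g))
  end.

Lemma sat_rename (A : Type) (R : A -> A -> Prop) n (phi : formula n) :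
  forall m (g : 'I_n -> 'I_m) e, sat R (rename phi g) e <-> sat R phi (e \o g).
Proof.
elim: phi => {n} [n i j|n i j|n p IH|n p IHp q IHq|n p IH] m g e //=.
- by rewrite IH.
- by rewrite IHp IHq.
have ext x : extend x e \o lift_map g = extend x (e \o g).
  apply: funext => i; rewrite /= /lift_map {2 3}/extend.
  by case: unlift => [j|]; rewrite (extendE x e).1 || rewrite (extendE x e).2.
split=> -[x] H; exists x; first by rewrite -ext; apply/IH.
by apply/IH; rewrite ext.
Qed.

(** * Combinatorics *)

Lemma card_le_enum (T : Type) (x0 : T) (X : set T) n :
  (X #<= `I_n)%card -> exists h : nat -> T, forall y, X y ->
  exists2 i, i < n & h i = y.
Proof.
move=> /pcard_leP/injfunPex[g gn ginj].
have /choice[h hP] : forall i, exists y, forall z, X z -> g z = i -> y = z.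
  move=> i; have [[z Xz gz]|N] := pselect (exists2 z, X z & g z = i).
    by exists z => z' Xz' gz'; apply: ginj; rewrite ?inE // gz.
  by exists x0 => z Xz gz; case: N; exists z.
by exists h => y Xy; exists (g y); [exact: gn|exact: hP].
Qed.

Lemma finite_set_listP (T : Type) (X : set T) :
  finite_set X <-> exists s : seq T, forall x, X x -> List.In x s.
Proof.
split=> [|[s Xs]].
  have [[x0 _]|N] := pselect (exists x, X x); last first.
    by exists [::] => x Xx; apply: N; exists x.
  case=> n; rewrite card_eq_le => /andP[/(card_le_enum x0)[h hP] _].
  suff [s sP] : exists s, forall i, i < n -> List.In (h i) s.
    by exists s => x /hP[i /sP] ? <-.
  elim: n {hP} => [|n [s sP]]; first by exists [::].
  exists (h n :: s) => i; rewrite ltnS leq_eqVlt => /orP[/eqP->|/sP]; first by left.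
  by right.
elim: s X Xs => [|a s IH] X Xs.
  by rewrite (_ : X = set0); [exact: finite_set0|apply/seteqP; split].
apply: (@sub_finite_set _ _ ([set a] `|` (X `&` ~` [set a]))).
  by move=> x Xx; have [->|xa] := pselect (x = a); [left|right].
rewrite finite_setU; split; first exact: finite_set1.
by apply: IH => x [/Xs [->|//]]; move/(_ erefl).
Qed.

(** Number the neighbours of each point.  Label an edge from [x] to [y] by the pair
    of the number of [y] at [x] and the number of [x] at [y]: either end point and
    the label determine the other one, so each label is a partial injection, and
    the swapped label is its inverse.  Off its domain [f l] is the identity. *)
Lemma edge_coloring (T : Type) (E : T -> T -> Prop) n :
  (forall x y, E x y -> E y x) ->
  (forall x, exists nb : nat -> T, forall y, E x y ->
     exists2 i, i < n & nb i = y) ->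
  exists (L : finType) (f : L -> T -> T),
    [/\ forall l x, f l x = x \/ E x (f l x),
        forall x y, E x y -> exists l, f l x = y
      & forall l, exists l', forall x, f l x = x \/ f l' (f l x) = x].
Proof.
move=> Esym /choice[nb nbP].
pose ok (i j : 'I_n) x := E x (nb x i) /\ nb (nb x i) j = x.
pose f (l : 'I_n * 'I_n) x := if `[< ok l.1 l.2 x >] then nb x l.1 else x.
exists ('I_n * 'I_n)%type, f; split.
- by move=> l x; rewrite /f; case: asboolP => [[Ex _]|_]; [right|left].
- move=> x y Exy; have [i ltin xi] := nbP _ _ Exy.
  have [j ltjn yj] := nbP _ _ (Esym _ _ Exy).
  exists (Ordinal ltin, Ordinal ltjn); rewrite /f; case: asboolP => // -[].
  by split=> /=; rewrite xi.
move=> [i j]; exists (j, i) => x; rewrite {1 3}/f /=; case: asboolP; last by left.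
move=> [Ex xx]; right; rewrite /f; case: asboolP => //= -[].
by split=> /=; rewrite xx //; exact: Esym.
Qed.

(** Each [P n] has infinitely many values of [pi], so a recursion can avoid the
    values used so far. *)
Lemma injective_choice (K T : Type) (pi : K -> T) (P : nat -> set K) :
  (forall n (s : seq T), exists2 k, P n k & ~ List.In (pi k) s) ->
  exists2 b : nat -> K, forall n, P n (b n) & injective (pi \o b).
Proof.
move=> H.
have /choice[g gP] : forall ns : nat * seq T, exists k,
    P ns.1 k /\ ~ List.In (pi k) ns.2.
  by move=> ns; have [k Pk nk] := H ns.1 ns.2; exists k.
pose fix used n := if n is m.+1 then pi (g (m, used m)) :: used m else [::].
pose b n := g (n, used n).
have usedP n m : n < m -> List.In (pi (b n)) (used m).
  elim: m => // m IH; rewrite ltnS leq_eqVlt => /orP[/eqP->|/IH nm]; first by left.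
  by right.
exists b => [n|n m /= E]; first by case: (gP (n, used n)).
have nlt i j : pi (b i) = pi (b j) -> ~ i < j.
  by move=> Eij /usedP; rewrite Eij; case: (gP (j, used j)).
by apply/eqP; case: ltngtP => // /nlt; rewrite E; case.
Qed.

(** The branches of the binary tree are continuum many almost disjoint sets of
    nodes, so a nonprincipal ultrafilter contains the image of at most one of them.
    A diagonal argument gives a branch [x] whose image belongs to none of the
    nonprincipal [p k].  A nonprincipal ultrafilter on [x] is mapped to a
    nonprincipal one that contains this image. *)
Lemma branch_escape (T : Type) (a : seq bool -> T) (p : nat -> Uf T) :
  injective a ->
  exists2 q : Uf (seq bool), forall m, q [set t | m <= size t] &
    forall k, umap a q <> p k.
Proof.
move=> ainj; pose br (x : nat -> bool) := a @` range (mkseq x).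
have /choice[xs xsP] : forall k, exists x, forall y, p k (br y) -> p k (br x).
  move=> k; have [[y py]|N] := pselect (exists y, p k (br y)).
    by exists y.
  by exists (fun=> true) => y py; case: N; exists y.
(* [xs k] is a branch whose image lies in [p k], if there is one; [x] differs from
   it at level [k]. *)
pose x k := ~~ xs k k.
have [G [GU oG]] := @ultraFilterLemma nat \oo _.
pose q := umap (mkseq x) (MkUf GU).
have large m : MkUf GU [set n | m <= n] by apply: oG; exists m.
exists q => [m|k qk].
  by apply: uf_subset (large m) => n /=; rewrite size_mkseq.
have /xsP : p k (br x).
  rewrite -qk; apply: uf_subset (@uf_setT _ (MkUf GU)) => n _.
  by exists (mkseq x n) => //; exists n.
rewrite -qk => /(uf_setI (large k.+1)) N; apply: (@uf_set0 _ (MkUf GU)).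
apply: uf_subset N => n [/= ltkn [_ [m _ <-] /ainj E]].
have mn : m = n by rewrite -(size_mkseq (xs k) m) E size_mkseq.
have := congr1 (nth true ^~ k) E; rewrite mn !nth_mkseq // /x.
by case: (xs k k).
Qed.

(** * Definable conditions on infinitely many variables *)

(** A term is a variable in [V] or a parameter in [A0]; the set of variables may be
    infinite, since a formula mentions only finitely many of them. *)
Definition assign (V A0 A : Type) (h : A0 -> A) (y : V -> A) (t : V + A0) : A :=
  match t with inl v => y v | inr a => h a end.

Definition update (V : eqType) (A : Type) (y : V -> A) (v : V) (a : A) : V -> A :=
  fun v' => if v' == v then a else y v'.

Section Definability.
Variables (A0 A1 : Type) (R0 : A0 -> A0 -> Prop) (R1 : A1 -> A1 -> Prop).
Variables (f : A0 -> A1) (f_elem : elementary R0 R1 f) (V : eqType).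

(** A condition on valuations that one formula defines in both structures, so that
    it transfers between them. *)
Definition definable (P0 : set (V -> A0)) (P1 : set (V -> A1)) :=
  exists n (phi : formula n) (g : 'I_n -> V + A0),
    (forall y, P0 y <-> sat R0 phi (assign id y \o g)) /\
    (forall y, P1 y <-> sat R1 phi (assign f y \o g)).

Lemma definable_eq (s t : V + A0) :
  definable [set y | assign id y s = assign id y t]
            [set y | assign f y s = assign f y t].
Proof.
exists 2, (Equ ord0 ord_max), (fun i => if i == ord0 then s else t).
by split.
Qed.

Lemma definable_rel (s t : V + A0) :
  definable [set y | R0 (assign id y s) (assign id y t)]
            [set y | R1 (assign f y s) (assign f y t)].
Proof.
exists 2, (Rel ord0 ord_max), (fun i => if i == ord0 then s else t).
by split.
Qed.

Lemma definable_not P0 P1 :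
  definable P0 P1 -> definable [set y | ~ P0 y] [set y | ~ P1 y].
Proof.
move=> [n [phi [g [d0 d1]]]]; exists n, (Neg phi), g.
by split=> y /=; rewrite ?d0 ?d1.
Qed.

Lemma definable_and P0 P1 Q0 Q1 : definable P0 P1 -> definable Q0 Q1 ->
  definable [set y | P0 y /\ Q0 y] [set y | P1 y /\ Q1 y].
Proof.
move=> [n [phi [g [d0 d1]]]] [m [psi [h [c0 c1]]]].
exists (n + m), (And (rename phi (lshift m)) (rename psi (@rshift n m))).
pose k (i : 'I_(n + m)) := match fintype.split i with inl i => g i | inr j => h j end.
have kl : k \o lshift m = g.
  by apply: funext => i; rewrite /k /= (unsplitK (inl i)).
have kr : k \o @rshift n m = h.
  by apply: funext => i; rewrite /k /= (unsplitK (inr i)).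
exists k; split=> y /=; rewrite ?d0 ?d1 ?c0 ?c1 !sat_rename -!compA.
  by rewrite kl kr.
by rewrite kl kr.
Qed.

Definition is_var (v : V) (t : V + A0) : bool :=
  if t is inl v' then v' == v else false.

(** The bound variable of the formula takes the place of all occurrences of [v];
    afterwards the indices that stood for [v] refer to nothing, which [a0] marks. *)
Lemma sat_bind (a0 : A0) (v : V) n (phi : formula n) (g : 'I_n -> V + A0) :
  let g' i := if is_var v (g i) then inr a0 else g i in
  let h i := if is_var v (g i) then ord0 else lift ord0 i in
  forall (A : Type) (R : A -> A -> Prop) (k : A0 -> A) y,
  sat R (Ex (rename phi h)) (assign k y \o g') <->
  exists a, sat R phi (assign k (update y v a) \o g).
Proof.
move=> g' h A R k y /=.
have E a : extend a (assign k y \o g') \o h = assign k (update y v a) \o g.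
  apply: funext => i; rewrite /= /h /g' /is_var.
  case gi : (g i) => [v'|a'] /=; last by rewrite (extendE _ _).2 /= gi.
  case: eqP => [->|/eqP vv].
    by rewrite (extendE _ _).1 /update eqxx.
  by rewrite (extendE _ _).2 /= gi (negPf vv) /= /update (negPf vv).
by split=> -[a Ha]; exists a; [rewrite -E; apply/sat_rename|apply/sat_rename; rewrite E].
Qed.

Lemma definable_ex (a0 : A0) (v : V) P0 P1 : definable P0 P1 ->
  definable [set y | exists a, P0 (update y v a)]
            [set y | exists a, P1 (update y v a)].
Proof.
move=> [n [phi [g [d0 d1]]]]; do 3!eexists.
split=> y; (apply: iff_trans; last exact: iff_sym (sat_bind a0 v phi g _ _ _)).
  by split=> -[a Ha]; exists a; apply/d0.
by split=> -[a Ha]; exists a; apply/d1.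
Qed.

Lemma definable_ext P0 P1 Q0 Q1 : definable P0 P1 ->
  (forall y, P0 y <-> Q0 y) -> (forall y, P1 y <-> Q1 y) -> definable Q0 Q1.
Proof.
move=> [n [phi [g [d0 d1]]]] PQ0 PQ1; exists n, phi, g.
by split=> y; rewrite -?PQ0 -?PQ1.
Qed.

Lemma definable_or P0 P1 Q0 Q1 : definable P0 P1 -> definable Q0 Q1 ->
  definable [set y | P0 y \/ Q0 y] [set y | P1 y \/ Q1 y].
Proof.
move=> /definable_not P /definable_not Q.
apply: (definable_ext (definable_not (definable_and P Q))) => y /=;
  by split=> [/not_andP|H]; [case=> /contrapT; [left|right]|
    case=> nP nQ; case: H].
Qed.

Lemma definable_true (a0 : A0) : definable setT setT.
Proof. by apply: (definable_ext (definable_eq (inr a0) (inr a0))). Qed.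

Lemma definable_all (a0 : A0) (K : eqType) (s : seq K)
    (P0 : K -> set (V -> A0)) (P1 : K -> set (V -> A1)) :
  (forall k, k \in s -> definable (P0 k) (P1 k)) ->
  definable [set y | forall k, k \in s -> P0 k y]
            [set y | forall k, k \in s -> P1 k y].
Proof.
elim: s => [_|k s IH d]; first exact: definable_ext (definable_true a0) _ _.
have ds : definable [set y | forall k, k \in s -> P0 k y]
            [set y | forall k, k \in s -> P1 k y].
  by apply: IH => k' k's; apply: d; rewrite in_cons k's orbT.
apply: (definable_ext (definable_and (d k (mem_head _ _)) ds)) => y /=;
  split=> [[Pk Ps] k'|H]; rewrite ?in_cons.
- by case/predU1P => [->|/Ps].
- by split=> [|k' k's]; apply: H; rewrite in_cons ?eqxx ?k's ?orbT.
- by case/predU1P => [->|/Ps].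
- by split=> [|k' k's]; apply: H; rewrite in_cons ?eqxx ?k's ?orbT.
Qed.

(** Quantifying the variables away one at a time leaves a sentence with
    parameters in [A0]. *)
Lemma definable_transfer (a0 : A0) P0 P1 (y1 : V -> A1) :
  definable P0 P1 -> P1 y1 -> exists y0, P0 y0.
Proof.
move=> [n [phi [g [d0 d1]]]] /d1 {d1}.
suff H (s : seq V) : forall n (phi : formula n) (g : 'I_n -> V + A0),
    (forall i v, g i = inl v -> v \in s) ->
    sat R1 phi (assign f y1 \o g) -> exists y0, sat R0 phi (assign id y0 \o g).
  move=> /(H (pmap (fun i => if g i is inl v then Some v else None) (enum 'I_n))).
  case=> [i v gi|y0 /d0]; last by exists y0.
  rewrite mem_pmap; apply/mapP; exists i; rewrite ?gi //.
  by rewrite mem_enum.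
elim: s => [|v s IH] {}n {d0} {}phi {}g gs Hphi.
  have gE i : exists a, g i = inr a.
    by case E : (g i) => [v|a]; [have := gs _ _ E|exists a].
  have [e eP] := choice gE.
  exists (fun=> a0); rewrite (_ : _ \o g = e).
    apply/f_elem; rewrite (_ : f \o e = assign f y1 \o g) //.
    by apply: funext => i /=; rewrite eP.
  by apply: funext => i /=; rewrite eP.
have := (sat_bind a0 v phi g R1 f y1).2; case.
  exists (y1 v); rewrite (_ : update y1 v (y1 v) = y1) //.
  by apply: funext => v'; rewrite /update; case: eqP => // ->.
move=> b Hb; have [|y0 /(sat_bind a0 v phi g R0 id y0).1[a Ha]] :=
  IH _ (Ex (rename phi _)) _ _ (ex_intro _ b Hb); last by eexists; exact: Ha.
move=> i v'; rewrite /is_var; case E : (g i) => [w|//].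
case: eqP => // vw [<-]; have := gs _ _ E.
by rewrite in_cons (negPf (introN eqP vw)).
Qed.

(** Finitely many candidate values for [y v] in [A0] can be excluded by the
    definable condition itself, and a value outside [A0] respects that. *)
Lemma definable_transfer_avoid (a0 : A0) P0 P1 (y1 : V -> A1) v (s : seq A0) :
  definable P0 P1 -> P1 y1 -> (forall a, y1 v <> f a) ->
  exists2 y0, P0 y0 & ~ List.In (y0 v) s.
Proof.
move=> dP Py1 y1v.
suff dPs : definable [set y | P0 y /\ ~ List.In (y v) s]
                     [set y | P1 y /\ ~ List.In (y v) (map f s)].
  have [|y0 [? ?]] := definable_transfer a0 dPs (y1 := y1); last by exists y0.
  split=> //; elim: s {dPs} => [|a s IH] /=; first by case.
  by case=> [/esym/y1v|/IH].
apply: definable_and => //.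
elim: s => [|a s IH].
  by apply: (definable_ext (definable_true a0)) => y; split=> // _ [].
apply: (definable_ext (definable_and (definable_not (definable_eq (inl v) (inr a))) IH)) => y /=;
  by split=> [[na ns] [/esym|]|N]; [| |split=> H; apply: N; [left|right]].
Qed.

End Definability.

(** * Ultrafilters moved along the edges *)

(** The points of [C] have infinite degree and are treated as constants; only the
    edges away from them, taken without direction, span components. *)
Definition edge (A : Type) (R : A -> A -> Prop) (C : set A) (x y : A) : Prop :=
  [/\ ~ C x, ~ C y & R x y \/ R y x].

Section Words.
Variables (A : Type) (R : A -> A -> Prop) (C : set A).
Variables (L : finType) (f : L -> A -> A).
Hypothesis f_edge : forall l x, f l x = x \/ edge R C x (f l x).
Hypothesis edge_f : forall x y, edge R C x y -> exists l, f l x = y.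
Hypothesis f_inv : forall l, exists l', forall x, f l x = x \/ f l' (f l x) = x.

Definition word (w : seq L) (x : A) : A := foldr f x w.

Lemma word_notin w x : ~ C x -> ~ C (word w x).
Proof.
move=> Cx; elim: w => //= l w IH.
by have [->//|[]] := f_edge l (word w x).
Qed.

(** [f l] is the identity on its fixed points and injective on all others; every
    ultrafilter contains one of the two sets. *)
Lemma ae_inj_f l (p : Uf A) : ae_inj p (f l).
Proof.
have [l' H] := f_inv l.
have [pf|/uf_setC pf] := pselect (p [set x | f l x = x]).
  by exists [set x | f l x = x] => // x y /= -> ->.
exists (~` [set x | f l x = x]) => // x y /= fx fy E.
by have [//|<-] := H x; rewrite E; case: (H y).
Qed.

Lemma ae_inj_word w (p : Uf A) : ae_inj p (word w).
Proof.
elim: w => [|l w IH]; first by exists setT => //; exact: uf_setT.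
exact: (ae_inj_comp IH (ae_inj_f l _)).
Qed.

Lemma umap_word_eq w w' (p : Uf A) :
  umap (word w) p = umap (word w') p <-> p [set x | word w x = word w' x].
Proof.
split; last exact: umap_ae.
by apply: umap_eq_ae; exact: ae_inj_word.
Qed.

Lemma umap_word_cons l w (p : Uf A) :
  umap (word (l :: w)) p = umap (f l) (umap (word w) p).
Proof. by rewrite umap_comp. Qed.

Lemma umap_word_cat w w' (p : Uf A) :
  umap (word (w ++ w')) p = umap (word w) (umap (word w') p).
Proof. by rewrite umap_comp; congr umap; apply: funext => x; exact: foldr_cat. Qed.

Lemma umap_word_inv w (p : Uf A) :
  exists w', umap (word w') (umap (word w) p) = p.
Proof.
elim: w => [|l w [w' IH]]; first by exists [::]; exact: uf_eq.
have [l' H] := f_inv l.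
have pE : umap (word w) p [set x | exists b : bool,
    if b then f l x = x else f l' (f l x) = x].
  apply: uf_subset (@uf_setT _ _) => x _.
  by have [E|E] := H x; [exists true|exists false].
have [[] pb] := uf_exists pE.
  by exists w'; rewrite umap_word_cons (umap_ae (s := f l) (t := id)) // umap_id.
exists (rcons w' l'); rewrite -cats1 umap_word_cat (umap_word_cons l w).
rewrite (umap_comp (f l)) -[in RHS]IH -[in RHS](umap_id (umap (word w) p)).
by congr umap; exact: umap_ae.
Qed.

(** An edge between ultrafilters is carried by one of the finitely many [f l]:
    otherwise some large set would have an image under [S] that is covered,
    off [C], by finitely many sets outside [p']. *)
Lemma ue_step (S : A -> A -> Prop) (p p' : Uf A) :
  (forall x y, S x y -> R x y \/ R y x) -> ~ p C -> ~ p' C -> ue S p p' ->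
  exists2 l, p' = umap (f l) p & p [set x | S x (f l x)].
Proof.
move=> SR /uf_setC pC /uf_setC p'C /ueE H.
apply: contrapT => /forall2NP N.
have /choice[X XP] : forall l, exists X, p X /\
    p' (~` (f l @` (X `&` [set x | S x (f l x)]))).
  move=> l; have [/uf_separate[Y p'Y pY]|/uf_setC pS] := N l.
    exists (f l @^-1` (~` Y)); split=> //; apply: uf_subset p'Y => y Yy.
    by case=> x [nY _ xy]; apply: nY; rewrite xy.
  exists (~` [set x | S x (f l x)]); split=> //.
  by apply: uf_subset (@uf_setT _ p') => y _ [x []].
have pX : p (~` C `&` [set x | forall l, X l x]).
  by apply: uf_setI => //; apply: uf_forall => l; case: (XP l).
have p'N : p' [set y | forall l, ~ (f l @` (X l `&` [set x | S x (f l x)])) y].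
  by apply: (@uf_forall _ p' _ (fun l => _)) => l; case: (XP l).
apply: (@uf_set0 _ p').
apply: uf_subset (uf_setI (uf_setI p'C (H _ pX)) p'N) => y.
case=> [[nCy [x [nCx Xx] Sxy]] n].
have [|l fl] := @edge_f x y; first by split=> //; exact: SR.
by apply: (n l); exists x => //; split; rewrite //= fl.
Qed.

(** Together with [umap_word_eq], this says that the atomic facts about the component
    of [p] hold exactly when they hold at almost every point of [p]. *)
Lemma ue_word w w' (p : Uf A) : ~ p C ->
  ue R (umap (word w) p) (umap (word w') p) <->
  p [set x | R (word w x) (word w' x)].
Proof.
move=> /uf_setC pC; split; last exact: ue_umap.
have wC v : ~ umap (word v) p C.
  by apply/uf_setC; apply: uf_subset pC => x /=; exact: word_notin.
move=> /ue_step-/(_ (fun x y => @or_introl _ _) (wC _) (wC _))[l].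
rewrite -umap_word_cons => /umap_word_eq pE pR; apply: uf_subset (uf_setI pE pR).
by move=> x [/= ->].
Qed.

End Words.

(** * Swapping two isomorphic components *)

(** [T] is an isomorphism between two unions of components, disjoint from each other
    and away from [N], which relates to the elements of [N] in the same way on both
    sides.  Exchanging the two and fixing everything else is an automorphism. *)
Lemma sat_swap (B : Type) (S : B -> B -> Prop) (N : set B)
    (T : B -> B -> Prop) :
  (forall x y x' y', T x y -> T x' y' -> x = x' <-> y = y') ->
  (forall x y x' y', T x y -> T x' y' -> S x x' <-> S y y') ->
  (forall x y z, T x y -> ~ T y z) ->
  (forall x y, T x y -> ~ N x /\ ~ N y) ->
  (forall x y z, T x y -> ~ N z -> S x z \/ S z x -> exists y', T z y') ->
  (forall x y z, T x y -> ~ N z -> S y z \/ S z y -> exists x', T x' z) ->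
  (forall x y z, T x y -> N z -> (S x z <-> S y z) /\ (S z x <-> S z y)) ->
  forall n (phi : formula n.+1) (e : 'I_n -> B) x y, T x y ->
  (forall i z, ~ T (e i) z /\ ~ T z (e i)) ->
  sat S phi (extend x e) <-> sat S phi (extend y e).
Proof.
move=> Teq TS disj TN nextl nextr special n phi e x y Txy eT.
pose off x := forall z, ~ T x z /\ ~ T z x.
pose E x y := [\/ T x y, T y x | x = y /\ off x].
have Etot z : exists z', E z z'.
  have [[z' ?]|N1] := pselect (exists z', T z z'); first by exists z'; constructor 1.
  have [[z' ?]|N2] := pselect (exists z', T z' z); first by exists z'; constructor 2.
  exists z; constructor 3; split=> // z'.
  by split=> ?; [apply: N1|apply: N2]; exists z'.
have Esym a b : E a b -> E b a.
  by case=> [?|?|[-> ?]]; [constructor 2|constructor 1|constructor 3].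
(* The three kinds of points are never adjacent to each other, except through
   [N], which sees both components alike. *)
have offS a b z : T a b -> off z -> (S a z <-> S b z) /\ (S z a <-> S z b).
  move=> Tab oz; have [Nz|Nz] := pselect (N z); first exact: special Tab Nz.
  have nl := nextl _ _ _ Tab Nz; have nr := nextr _ _ _ Tab Nz.
  by split; split=> Saz; exfalso;
    [have [? /(oz _).1] := nl (or_introl Saz)|have [? /(oz _).2] := nr (or_introl Saz)
    |have [? /(oz _).1] := nl (or_intror Saz)|have [? /(oz _).2] := nr (or_intror Saz)].
have cross a b a' b' : T a b -> T a' b' ->
    (S a b' <-> S b a') /\ (S b' a <-> S a' b).
  move=> Tab Tab'; have [Na' Nb'] := TN _ _ Tab'.
  have nl := nextl _ _ _ Tab Nb'; have nr := nextr _ _ _ Tab Na'.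
  by split; split=> Sab; exfalso;
    [have [? /(disj _ _ _ Tab')] := nl (or_introl Sab)
    |have [? /disj-/(_ _ Tab')] := nr (or_introl Sab)
    |have [? /(disj _ _ _ Tab')] := nl (or_intror Sab)
    |have [? /disj-/(_ _ Tab')] := nr (or_intror Sab)].
have ext i : E (extend x e i) (extend y e i).
  rewrite /extend; case: unlift => [j|]; last by constructor 1.
  by constructor 3; split=> // z; exact: eT.
apply: sat_back_and_forth ext => //.
- by move=> b; have [a /Esym] := Etot b; exists a.
- move=> a b a' b' [Tab|Tba|[<- oa]] [Tab'|Tba'|[<- oa']] //.
  + exact: Teq.
  + by split=> E'; [rewrite E' in Tab|rewrite E' in Tab];
      case: (disj _ _ _ Tba' Tab) || case: (disj _ _ _ Tab Tba').
  + by split=> E'; [case: (oa' b).1; rewrite -E'|case: (oa' a).2; rewrite -E'].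
  + by split=> E'; [rewrite E' in Tba|rewrite E' in Tba];
      case: (disj _ _ _ Tab' Tba) || case: (disj _ _ _ Tba Tab').
  + by apply: iff_sym; exact: Teq.
  + by split=> E'; [case: (oa' b).2; rewrite -E'|case: (oa' a).1; rewrite -E'].
  + by split=> E'; [case: (oa b').1; rewrite E'|case: (oa a').2; rewrite E'].
  + by split=> E'; [case: (oa b').2; rewrite E'|case: (oa a').1; rewrite E'].
move=> a b a' b' [Tab|Tba|[<- oa]] [Tab'|Tba'|[<- oa']] //.
- exact: TS.
- by have [] := cross _ _ _ _ Tab Tba'.
- by have [] := offS _ _ _ Tab oa'.
- by apply: iff_sym; have [] := cross _ _ _ _ Tba Tab'.
- by apply: iff_sym; exact: TS.
- by apply: iff_sym; have [] := offS _ _ _ Tba oa'.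
- by have [] := offS _ _ _ Tab' oa.
- by apply: iff_sym; have [] := offS _ _ _ Tba' oa.
Qed.

(** * The geometry of an elementary extension *)

(** The two directions of [R] are handled by one argument. *)
Definition orient (A : Type) (R : A -> A -> Prop) (b : bool) : A -> A -> Prop :=
  fun x y => if b then R x y else R y x.

Lemma list_lift (A B : Type) (f : A -> B) (Q : set B) (s : seq B) :
  injective f ->
  exists s', forall a, List.In a s' <-> List.In (f a) s /\ Q (f a).
Proof.
move=> finj; elim: s => [|c s [s' IH]]; first by exists [::] => a; split=> [[]|[]].
have [[a [ac Qc]]|N] := pselect (exists a, f a = c /\ Q c).
  exists (a :: s') => b /=; split.
    case=> [<-|/IH[? ?]]; last by split=> //; right.
    by rewrite ac; split=> //; left.
  case=> -[cb|fbs] Qb; last by right; apply/IH.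
  by left; apply: finj; rewrite ac.
exists s' => b; split=> [/IH[? ?]|[[cb|fbs] Qb]]; [by split=> //; right| |by apply/IH].
by case: N; exists b; rewrite cb.
Qed.

Lemma In_nth (A : Type) (a0 a : A) (s : seq A) :
  List.In a s <-> exists2 k, k < size s & nth a0 s k = a.
Proof.
elim: s => [|c s IH]; first by split=> // -[].
split=> [[->|/IH[k ks ka]]|[[|k] /= ks ka]]; first by exists 0.
- by exists k.+1.
- by left.
- by right; apply/IH; exists k.
Qed.

Section Extension.
Variables (A1 : Type) (A0 : set A1) (R0 : A0 -> A0 -> Prop).
Variable R1 : A1 -> A1 -> Prop.
Hypotheses (ab0 : almost_bounded R0) (ab1 : almost_bounded R1).
Hypothesis elem : elementary R0 R1 (fun x : A0 => set_val x).

Notation sval := (fun x : A0 => set_val x).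
Notation C := (infinite_degree R1).

Lemma sval_inj : injective sval.
Proof. exact: val_inj. Qed.

Lemma svalP x : A0 x -> exists a : A0, set_val a = x.
Proof. by move=> A0x; exists (SigSub (mem_set A0x)). Qed.

Lemma sval_in (a : A0) : A0 (set_val a).
Proof. exact: set_valP. Qed.

Lemma rel_sval a b : R0 a b <-> R1 (set_val a) (set_val b).
Proof.
exact: (elem (Rel (ord0 : 'I_2) ord_max) (fun i => if i == ord0 then a else b)).
Qed.

Lemma base_inhabited : A1 -> inhabited A0.
Proof.
move=> x.
have e : 'I_0 -> A0 by case.
have [_ []] := elem (Ex (Equ ord0 ord0)) e; last by move=> a _; split.
by exists x.
Qed.

Lemma definable_orient (V : eqType) b (s t : V + A0) :
  definable R0 R1 sval
    [set y | orient R0 b (assign id y s) (assign id y t)]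
    [set y | orient R1 b (assign sval y s) (assign sval y t)].
Proof. by case: b; exact: definable_rel. Qed.

(** Having more than [n] neighbours is definable.  If it held at a point outside
    [A0], it would hold at infinitely many points of [A0], whereas all but
    finitely many points of [A0] have at most [n] neighbours. *)
Lemma infinite_degree_base x : C x -> A0 x.
Proof.
move=> Cx; apply: contrapT => nA0x; have [a0] := base_inhabited x.
have [b inf] : exists b, infinite_set [set y | orient R1 b x y].
  by case: Cx => inf; [exists true|exists false].
have [s0 s0P] := (finite_set_listP _).1 ab0.1; have [n nP] := ab0.2.
have [z zX zinj] : exists2 z : nat -> A1,
    forall i, orient R1 b x (z i) & injective (id \o z).
  apply: (injective_choice (P := fun=> [set y | orient R1 b x y])) => _ s.
  apply: contrapT => /forall2NP N; apply: inf; apply/finite_set_listP; exists s.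
  by move=> y xy; case: (N y) => // /contrapT.
pose P A (S : A -> A -> Prop) (y : nat -> A) := forall i, i \in iota 0 n.+1 ->
  orient S b (y 0) (y i.+1) /\ forall j, j \in iota 0 i -> y i.+1 <> y j.+1.
have dP : definable R0 R1 sval (P _ R0) (P _ R1).
  apply: (@definable_all _ _ _ _ sval _ a0) => i _; apply: definable_and.
    exact: (definable_orient b (inl 0) (inl i.+1)).
  apply: (@definable_all _ _ _ _ sval _ a0) => j _.
  exact: (definable_not (definable_eq R0 R1 sval (inl i.+1) (inl j.+1))).
have [||y Py ns] := definable_transfer_avoid (v := 0) elem a0 s0 dP
    (y1 := fun i => if i is j.+1 then z j else x) _ _ => //.
- move=> i _; split; first exact: zX.
  by move=> j; rewrite mem_iota add0n => /= ji /zinj E; rewrite E ltnn in ji.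
- by move=> a /= E; apply: nA0x; rewrite E; exact: sval_in.
have bound : ([set a | orient R0 b (y 0) a] #<= `I_n)%card.
  have [|] := nP (y 0); first by move=> /s0P.
  by case: b {inf zX P dP Py}.
have [h hP] := card_le_enum a0 bound.
have /choice[k kP] : forall i, exists k, i < n.+1 -> k < n /\ h k = y i.+1.
  move=> i; case: (ltnP i n.+1) => [lti|_]; last by exists 0.
  have [|/hP[k ltk hk] _] := Py i; first by rewrite mem_iota.
  by exists k.
suff : (`I_(n.+1) #<= `I_n)%card by rewrite card_le_II ltnn.
apply/pcard_leP/injfunPex; exists k => [i /kP[]//|i j].
have kinj i' j' : j' < i' -> i' < n.+1 -> k i' <> k j'.
  move=> ji ltin E; have [_ hi] := kP _ ltin.
  have [_ hj] := kP _ (ltn_trans ji ltin).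
  have [|_ /(_ j')] := Py i'; first by rewrite mem_iota.
  by rewrite mem_iota -hi -hj E; apply.
rewrite !inE => /= lti ltj E; apply/eqP; case: ltngtP => // ij.
  by case: (kinj _ _ ij ltj).
by case: (kinj _ _ ij lti).
Qed.

(** A neighbour outside [A0] of [a : A0] would, by elementarity, force [a] to
    have infinitely many neighbours in [A0]. *)
Lemma base_closed x y : A0 x -> ~ C x -> R1 x y \/ R1 y x -> A0 y.
Proof.
move=> /svalP[a <-] nC xy; apply: contrapT => nA0y.
have [b Rxy] : exists b, orient R1 b (set_val a) y.
  by case: xy => ?; [exists true|exists false].
have /finite_set_listP[s sP] : finite_set [set z | orient R1 b (set_val a) z].
  by apply: contrapT => inf; apply: nC; case: b inf {Rxy}; [left|right].
have [s' s'P] := list_lift setT s sval_inj.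
have [||y0 Ry ns] := definable_transfer_avoid (v := tt) elem a s'
    (definable_orient b (inr a) (inl tt)) (y1 := fun=> y) => //.
  by move=> c E; apply: nA0y; rewrite E; exact: sval_in.
apply: ns; apply/s'P; split=> //; apply: sP.
by case: b Ry {Rxy} => /rel_sval.
Qed.

Lemma edge_base x y : edge R1 C x y -> A0 x <-> A0 y.
Proof.
case=> nCx nCy xy; split=> [A0x|A0y]; first exact: base_closed A0x nCx xy.
by apply: base_closed A0y nCy _; case: xy; [right|left].
Qed.

Lemma edge_coloring_off_C : exists (L : finType) (f : L -> A1 -> A1),
    [/\ forall l x, f l x = x \/ edge R1 C x (f l x),
        forall x y, edge R1 C x y -> exists l, f l x = y
      & forall l, exists l', forall x, f l x = x \/ f l' (f l x) = x].
Proof.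
have [n nP] := ab1.2; apply: (@edge_coloring _ _ (n + n)).
  by move=> x y [nx ny [xy|yx]]; split=> //; [right|left].
move=> x; have [Cx|nCx] := pselect (C x); first by exists (fun=> x) => y [].
have [/(card_le_enum x)[h hP] /(card_le_enum x)[k kP]] := nP _ nCx.
exists (fun i => if i < n then h i else k (i - n)) => y [_ _ [/hP|/kP]] [i ltin <-].
  by exists i; rewrite ?ltin // ltn_addr.
by exists (n + i); rewrite ?ltn_add2l // ltnNge leq_addr /= addKn.
Qed.

Lemma infinite_degree_list (a0 : A0) : exists cs : seq A0, forall x,
  C x <-> exists2 k, k < size cs & x = set_val (nth a0 cs k).
Proof.
have [s sP] := (finite_set_listP _).1 ab1.1.
have [cs csP] := list_lift C s sval_inj.
exists cs => x; split=> [Cx|[k kcs ->]].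
  have [a ax] := svalP (infinite_degree_base Cx).
  have /In_nth-/(_ a0)[k ? ka] : List.In a cs by apply/csP; rewrite ax; split=> //; exact: sP.
  by exists k; rewrite ?ka.
have [] // : List.In (set_val (nth a0 cs k)) s /\ C (set_val (nth a0 cs k)).
by apply/csP/In_nth; exists k.
Qed.

End Extension.

(** * Copying a component into the base *)

Section Copy.
Variables (A1 : Type) (A0 : set A1) (R0 : A0 -> A0 -> Prop).
Variable R1 : A1 -> A1 -> Prop.
Hypothesis ab0 : almost_bounded R0.
Hypothesis elem : elementary R0 R1 (fun x : A0 => set_val x).

Notation sval := (fun x : A0 => set_val x).
Notation C := (infinite_degree R1).

Variables (L : finType) (f : L -> A1 -> A1).
Hypothesis f_edge : forall l x, f l x = x \/ edge R1 C x (f l x).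
Hypothesis edge_f : forall x y, edge R1 C x y -> exists l, f l x = y.
Hypothesis f_inv : forall l, exists l', forall x, f l x = x \/ f l' (f l x) = x.
Variables (a0 : A0) (cs : seq A0).
Hypothesis csP : forall x,
  C x <-> exists2 k, k < size cs & x = set_val (nth a0 cs k).

Notation W := (seq L).

Definition term := (W + nat)%type.

(** The variable [None] is kept free, to be bound in the patterns [inr w] below. *)
Definition term_var (t : term) : option W + A0 :=
  match t with inl w => inl (Some w) | inr k => inr (nth a0 cs k) end.

(** The atoms [inl (b, (s, t))] describe the structure on the points named by
    terms; the patterns [inr w] keep a realization from having further neighbours. *)
Definition pattern := (bool * (term * term) + W)%type.

Definition holds (A : Type) (R : A -> A -> Prop) (h : A0 -> A) (pt : pattern)
    (y : option W -> A) : Prop :=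
  match pt with
  | inl (b, (s, t)) =>
      let a := assign h y (term_var s) in
      let a' := assign h y (term_var t) in
      if b then a = a' else R a a'
  | inr w => forall z, R (y (Some w)) z \/ R z (y (Some w)) ->
      (exists2 k, k < size cs & z = h (nth a0 cs k)) \/
      exists l, z = y (Some (l :: w))
  end.

Lemma holds_definable pt :
  definable R0 R1 sval (holds R0 id pt) (holds R1 sval pt).
Proof.
case: pt => [[[] [s t]]|w]; first exact: definable_eq.
  exact: definable_rel.
pose P A (R : A -> A -> Prop) (h : A0 -> A) (y : option W -> A) :=
  (R (y (Some w)) (y None) \/ R (y None) (y (Some w))) /\
  ((forall k, k \in iota 0 (size cs) -> y None <> h (nth a0 cs k)) /\
   (forall l, l \in enum L -> y None <> y (Some (l :: w)))).
have dP : definable R0 R1 sval (P _ R0 id) (P _ R1 sval).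
  apply: definable_and.
    apply: definable_or.
      exact: (definable_rel _ _ _ (inl (Some w)) (inl None)).
    exact: (definable_rel _ _ _ (inl None) (inl (Some w))).
  apply: definable_and.
    apply: (@definable_all _ _ _ _ sval _ a0) => k _.
    exact: (definable_not (definable_eq R0 R1 sval (inl None) (inr _))).
  apply: (@definable_all _ _ _ _ sval _ a0) => l _.
  exact: (definable_not (definable_eq R0 R1 sval (inl None) (inl (Some (l :: w))))).
have PE A (R : A -> A -> Prop) h y :
    (~ exists z, P A R h (update y None z)) <-> holds R h (inr w) y.
  split=> [N z Rz|H [z [Rz [zc zl]]]].
    apply: contrapT => /not_orP[/forall2NP nk nl]; apply: N; exists z.
    split=> //; split=> [k|l _ zl]; last by apply: nl; exists l.
    by rewrite mem_iota => kcs; case: (nk k).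
  have [[k kcs zk]|[l zl']] := H z Rz; first by apply: (zc k); rewrite ?mem_iota.
  by apply: (zl l); rewrite ?mem_enum.
by apply: (definable_ext (definable_not (definable_ex a0 None dP))) => y; exact: PE.
Qed.

Variable u : Uf A1.
Hypothesis uA0 : ~ u A0.

Definition valuation (d : A1) (v : option W) : A1 :=
  if v is Some w then word f w d else d.

Definition holds_at_u (pt : pattern) : Prop :=
  u [set d | holds R1 sval pt (valuation d)].

(** For growing [r], these conditions approximate a complete description of the
    component of [u]. *)
Definition agrees (A : Type) (R : A -> A -> Prop) (h : A0 -> A) (r : nat)
    (y : option W -> A) : Prop :=
  forall pt, pt \in pmap unpickle (iota 0 r) ->
  (holds R h pt y <-> holds_at_u pt).

Lemma agrees_definable r :
  definable R0 R1 sval (agrees R0 id r) (agrees R1 sval r).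
Proof.
apply: (@definable_all _ _ _ _ sval _ a0) => pt _; have d := holds_definable pt.
have [H|H] := pselect (holds_at_u pt).
  by apply: (definable_ext d) => y; split=> // -[_]; apply.
by apply: (definable_ext (definable_not d)) => y; split=> [n|[hu _] /hu//];
  split=> // /n.
Qed.

Lemma agrees_at_u r : u [set d | agrees R1 sval r (valuation d)].
Proof.
apply: (@uf_forall_in _ u _ _ (fun pt => [set d | _])) => pt _.
have [H|H] := pselect (holds_at_u pt).
  by apply: uf_subset (H) => d Hd; split.
by have /uf_setC := H; apply: uf_subset => d nd; split=> // /H.
Qed.

(** Almost all [d] in [u] lie outside [A0] and satisfy the first [n] patterns as [u]
    prescribes.  By [definable_transfer_avoid], these patterns are realized
    infinitely often in [A0].  Indexing the realizations by the nodes of the binary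
    tree prepares for [branch_escape]. *)
Lemma exists_copies : exists2 y : seq bool -> option W -> A0,
  forall t, agrees R0 id (size t) (y t) &
  injective (fun t => y t (Some [::])).
Proof.
pose pi (y : option W -> A0) := y (Some [::]).
pose sz n := size (odflt [::] (unpickle n : option (seq bool))).
have [|b bP binj] := injective_choice (pi := pi) (P := fun n => agrees R0 id (sz n)).
  move=> n s; have /uf_setC uD := uA0.
  have [d [nd ad]] : exists d, ~ A0 d /\ agrees R1 sval (sz n) (valuation d).
    apply: contrapT => /forallNP N; apply: (@uf_set0 _ u).
    apply: uf_subset (uf_setI uD (agrees_at_u (sz n))) => d [nd ad].
    by case: (N d).
  apply: (definable_transfer_avoid elem a0 s (agrees_definable (sz n)) ad).
  by move=> a E; apply: nd; rewrite (_ : d = set_val a) //; exact: sval_in.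
exists (fun t => b (pickle t)) => [t|t t' /binj/(pcan_inj pickleK)//].
by have := bP (pickle t); rewrite /sz pickleK.
Qed.

Section Limit.
Variables (y : seq bool -> option W -> A0) (q : Uf (seq bool)).
Hypothesis y_agrees : forall t, agrees R0 id (size t) (y t).
Hypothesis q_large : forall m, q [set t | m <= size t].

Lemma holds_limit pt : holds_at_u pt <-> q [set t | holds R0 id pt (y t)].
Proof.
have qa : q [set t | holds R0 id pt (y t) <-> holds_at_u pt].
  apply: uf_subset (q_large (pickle pt).+1) => t /= ltt; apply: y_agrees.
  by rewrite mem_pmap -[Some pt]pickleK map_f // mem_iota.
split=> H; first by apply: uf_subset qa => t /= ->.
apply: contrapT => nH; apply: (@uf_set0 _ q); apply: uf_subset (uf_setI qa H).
by move=> t [/= E] /E.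
Qed.

Definition copy (w : W) (t : seq bool) : A1 := set_val (y t (Some w)).

Lemma copy_eq w w' : u [set d | word f w d = word f w' d] <->
  q [set t | copy w t = copy w' t].
Proof.
apply: (iff_trans (holds_limit (inl (true, (inl w, inl w'))))).
by split; apply: uf_subset => t; [rewrite /copy /= => ->|move/sval_inj].
Qed.

Lemma copy_eq_const w k : u [set d | word f w d = set_val (nth a0 cs k)] <->
  q [set t | copy w t = set_val (nth a0 cs k)].
Proof.
apply: (iff_trans (holds_limit (inl (true, (inl w, inr k))))).
by split; apply: uf_subset => t; [rewrite /copy /= => ->|move/sval_inj].
Qed.

Lemma copy_rel w w' : u [set d | R1 (word f w d) (word f w' d)] <->
  q [set t | R1 (copy w t) (copy w' t)].
Proof.
apply: (iff_trans (holds_limit (inl (false, (inl w, inl w'))))).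
by split; apply: uf_subset => t /(rel_sval elem).
Qed.

Lemma copy_rel_const w k :
  (u [set d | R1 (word f w d) (set_val (nth a0 cs k))] <->
   q [set t | R1 (copy w t) (set_val (nth a0 cs k))]) /\
  (u [set d | R1 (set_val (nth a0 cs k)) (word f w d)] <->
   q [set t | R1 (set_val (nth a0 cs k)) (copy w t)]).
Proof.
split.
  apply: (iff_trans (holds_limit (inl (false, (inl w, inr k))))).
  by split; apply: uf_subset => t /(rel_sval elem).
apply: (iff_trans (holds_limit (inl (false, (inr k, inl w))))).
by split; apply: uf_subset => t /(rel_sval elem).
Qed.

Lemma notin_C_at_u : ~ u C.
Proof.
move/uf_subset => H; apply: uA0; apply: H => x.
exact: infinite_degree_base ab0 elem x.
Qed.

Lemma word_outside w d : ~ A0 d -> ~ A0 (word f w d).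
Proof.
move=> nd; elim: w => //= l w IH.
have [->//|e] := f_edge l (word f w d).
by move/(edge_base elem e).
Qed.

Lemma copy_notin_C w : q [set t | ~ C (copy w t)].
Proof.
apply/uf_setC => qC.
have /uf_exists[k] : q [set t | exists k : 'I_(size cs),
    copy w t = set_val (nth a0 cs k)].
  by apply: uf_subset qC => t /csP[k kcs E]; exists (Ordinal kcs).
move/copy_eq_const => E; have /uf_setC uD := uA0.
apply: (@uf_set0 _ u); apply: uf_subset (uf_setI uD E) => d [nd /= dE].
by apply: (word_outside (w := w) nd); rewrite dE; exact: sval_in.
Qed.

(** The copies of the points [word f w d] need not be given by the same words,
    but by some words: the labels of the finitely many possible steps are
    constant on a large set. *)
Lemma copy_word w : exists w', q [set t | copy w t = word f w' (copy [::] t)].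
Proof.
elim: w => [|l w [w' IH]].
  by exists [::]; apply: uf_subset (@uf_setT _ q).
have [/(copy_eq (l :: w) w) E|/uf_setC ne] :=
    pselect (u [set d | f l (word f w d) = word f w d]).
  by exists w'; apply: uf_subset (uf_setI E IH) => t [/= ->].
have /uf_exists[b Rb] : u [set d | exists b : bool,
    orient R1 b (word f w d) (word f (l :: w) d)].
  apply: uf_subset ne => d /= nd; have [//|[_ _ [H|H]]] := f_edge l (word f w d).
    by exists true.
  by exists false.
have qb : q [set t | R1 (copy w t) (copy (l :: w) t) \/
                     R1 (copy (l :: w) t) (copy w t)].
  case: b Rb => /copy_rel; apply: uf_subset => t; [by left|by right].
have /uf_exists[l' ql'] : q [set t | exists l', f l' (copy w t) = copy (l :: w) t].
  have qC := uf_setI (copy_notin_C w) (copy_notin_C (l :: w)).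
  by apply: uf_subset (uf_setI qC qb) => t [[? ?] ?]; exact: edge_f.
by exists (l' :: w'); apply: uf_subset (uf_setI ql' IH) => t [/= <- ->].
Qed.

Notation lim w := (umap (copy w) q).

(** The limit of the copies at [w] is a translate of the limit at the empty word,
    so that equality and edges in its component are decided almost everywhere by
    [umap_word_eq] and [ue_word]. *)
Lemma lim_word w : exists2 w', lim w = umap (word f w') (lim [::]) &
  q [set t | copy w t = word f w' (copy [::] t)].
Proof.
have [w' E] := copy_word w; exists w' => //.
by rewrite umap_comp; exact: umap_ae.
Qed.

Lemma lim_notin_C w : ~ lim w C.
Proof. by apply/uf_setC; exact: copy_notin_C. Qed.

Lemma lim_eq w w' : umap (word f w) u = umap (word f w') u <-> lim w = lim w'.
Proof.
have [v -> vE] := lim_word w; have [v' -> v'E] := lim_word w'.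
rewrite !(umap_word_eq f_inv) copy_eq; split=> H.
  by apply: uf_subset (uf_setI (uf_setI vE v'E) H) => t [[/= <- <-]].
by apply: uf_subset (uf_setI (uf_setI vE v'E) H) => t [[/= -> ->]].
Qed.

Lemma lim_ue w w' : ue R1 (umap (word f w) u) (umap (word f w') u) <->
  ue R1 (lim w) (lim w').
Proof.
rewrite (ue_word f_edge edge_f f_inv _ _ notin_C_at_u) copy_rel.
have [v -> vE] := lim_word w; have [v' -> v'E] := lim_word w'.
rewrite (ue_word f_edge edge_f f_inv _ _ (@lim_notin_C [::])); split=> H.
  by apply: uf_subset (uf_setI (uf_setI vE v'E) H) => t [[/= <- <-]].
by apply: uf_subset (uf_setI (uf_setI vE v'E) H) => t [[/= -> ->]].
Qed.

Lemma word_special w (z : Uf A1) : z C ->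
  (ue R1 (umap (word f w) u) z <-> ue R1 (lim w) z) /\
  (ue R1 z (umap (word f w) u) <-> ue R1 z (lim w)).
Proof.
move=> zC.
have /uf_exists[k zk] : z [set x | exists k : 'I_(size cs),
    x = set_val (nth a0 cs k)].
  by apply: uf_subset zC => x /csP[k kcs E]; exists (Ordinal kcs).
have [to from] := copy_rel_const w k; split.
  have conv p : ue R1 p z <-> p [set x | R1 x (set_val (nth a0 cs k))].
    rewrite -(ue_principal (fun x y => R1 y x) p zk).
    by split=> /ue_conv.
  by rewrite !conv.
by rewrite !(ue_principal R1 _ zk).
Qed.

Lemma ue_orient (p p' : Uf A1) : ue R1 p p' \/ ue R1 p' p ->
  exists b, ue (orient R1 b) p p'.
Proof. by case=> [H|/ue_conv H]; [exists true|exists false]. Qed.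

Lemma orient_sym b x x' : orient R1 b x x' -> R1 x x' \/ R1 x' x.
Proof. by case: b; [left|right]. Qed.

Lemma component_next w (z : Uf A1) : ~ z C ->
  ue R1 (umap (word f w) u) z \/ ue R1 z (umap (word f w) u) ->
  exists w', z = umap (word f w') u.
Proof.
move=> nzC /ue_orient[b].
have nC : ~ umap (word f w) u C.
  apply/uf_setC; have /uf_setC := notin_C_at_u; apply: uf_subset => x.
  exact: word_notin.
move=> /(ue_step edge_f (@orient_sym b) nC nzC)[l -> _].
by exists (l :: w); rewrite umap_comp.
Qed.

(** The pattern [inr w] confines the neighbours of almost every [copy w t] in
    [A0] to [C] and the points [copy (l :: w) t], and [copy w t] has no neighbours
    outside [A0]. *)
Lemma copy_next w (z : Uf A1) : ~ z C -> ue R1 (lim w) z \/ ue R1 z (lim w) ->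
  exists w', z = lim w'.
Proof.
move=> nzC /ue_orient[b].
move=> /(ue_step edge_f (@orient_sym b) (@lim_notin_C w) nzC)[l -> qS].
(* For [d] outside [A0], all neighbours of [word f w d] off [C] are among its
   images under the [f l]. *)
have closed : holds_at_u (inr w).
  have /uf_setC uD := uA0; apply: uf_subset uD => d nd z' zd.
  have [/csP ?|nCz] := pselect (C z'); [by left|right].
  have [|l' <-] := @edge_f (word f w d) z'; last by exists l'.
  split=> //; apply: (word_notin f_edge) => Cd; apply: nd.
  exact: infinite_degree_base ab0 elem _ Cd.
have /uf_exists[l' E] : q [set t | exists l', f l (copy w t) = copy (l' :: w) t].
  have /holds_limit qc := closed.
  apply: uf_subset (uf_setI (uf_setI (copy_notin_C w) qS) qc) => t.
  case=> [[nC /= St] ct]; have adj := orient_sym St.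
  have nCl : ~ C (f l (copy w t)) by have [->|[]] := f_edge l (copy w t).
  have [a aE] := svalP (base_closed elem (sval_in _) nC adj).
  have [|[k kcs ak]|[l' al']] := ct a; last by exists l'; rewrite -aE al'.
    by move: adj; rewrite -aE /copy !(rel_sval elem).
  by case: nCl; apply/csP; exists k; rewrite // -aE ak.
by exists (l' :: w); rewrite umap_comp; exact: umap_ae.
Qed.

End Limit.

Lemma component_outside w : ~ umap (word f w) u A0.
Proof.
by apply/uf_setC; have /uf_setC := uA0; apply: uf_subset => d; exact: word_outside.
Qed.

(** [T] matches the component of [u] with the component of the limit of the copies;
    they are disjoint, as one lives outside [A0] and the other inside it.
    [branch_escape] keeps the limit out of the countably many points of the
    components of the parameters, so the swap fixes these. *)
Lemma exists_twin n (e : 'I_n -> Uf A0) : exists v : Uf A0,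
  forall phi : formula n.+1,
  sat (ue R1) phi (extend u (fun i => uf_incl (e i))) <->
  sat (ue R1) phi (extend (uf_incl v) (fun i => uf_incl (e i))).
Proof.
have [y y_agrees y_inj] := exists_copies.
pose p k := if unpickle k is Some (i, w) then umap (word f w) (uf_incl (e i)) else u.
have [t t' /sval_inj/y_inj//|q q_large escape] := @branch_escape _ (copy y [::]) p.
exists (umap (fun t => y t (Some [::])) q) => phi.
rewrite [uf_incl (umap _ _)]uf_incl_umap umap_comp.
pose lim w := umap (copy y w) q.
have limA0 w : lim w A0.
  by rewrite /lim /=; apply: uf_subset (@uf_setT _ q) => t _; exact: sval_in.
pose T x x' := exists w, x = umap (word f w) u /\ x' = lim w.
apply: (@sat_swap _ _ (fun z : Uf A1 => z C) T).
- by move=> _ _ _ _ [w [-> ->]] [w' [-> ->]]; exact: lim_eq.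
- by move=> _ _ _ _ [w [-> ->]] [w' [-> ->]]; exact: lim_ue.
- move=> _ x _ [w [_ ->]] [w' [E _]]; apply: (@component_outside w').
  by rewrite -E.
- move=> _ _ [w [-> ->]]; split; last exact: lim_notin_C.
  move=> uC; apply: (@component_outside w); apply: uf_subset uC => x.
  exact: infinite_degree_base ab0 elem x.
- move=> _ _ z [w [-> _]] nzC /(component_next nzC)[w' ->].
  by exists (lim w'), w'.
- move=> _ _ z [w [_ ->]] nzC /(copy_next y_agrees q_large nzC)[w' ->].
  by exists (umap (word f w') u), w'.
- by move=> _ _ z [w [-> ->]]; exact: word_special.
- by exists [::]; split=> //; exact: uf_eq.
move=> i z; split=> -[w [E1 E2]].
  apply: (@component_outside w); rewrite -E1.
  by apply: uf_subset (@uf_setT _ (e i)) => a _; exact: sval_in.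
(* If [e i] is a translate of the limit [lim [::]], then [lim [::]] is one of
   [e i], which is among the ultrafilters that were avoided. *)
have [w' lw _] := lim_word y_agrees q_large w.
have [v vE] := umap_word_inv f_inv w' (lim [::]).
apply: (escape (pickle (i, v))); rewrite /p pickleK E2 /lim lw.
exact: esym.
Qed.

End Copy.

(** * The inclusion of the ultrafilter extensions *)

Lemma uf_incl_inj (A1 : Type) (A0 : set A1) : injective (@uf_incl A1 A0).
Proof.
move=> p p' E; apply: uf_eq => X pX.
have : uf_incl p (set_val @` X) by apply: uf_subset pX => a Xa; exists a.
by rewrite E /=; apply: uf_subset => a [a' Xa' /val_inj <-].
Qed.

Lemma ue_uf_incl (A1 : Type) (A0 : set A1) (R0 : A0 -> A0 -> Prop)
    (R1 : A1 -> A1 -> Prop) (p p' : Uf A0) :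
  (forall a b, R0 a b <-> R1 (set_val a) (set_val b)) ->
  ue R0 p p' <-> ue R1 (uf_incl p) (uf_incl p').
Proof.
move=> R01; split=> /ueE H; apply/ueE => X pX.
  apply: uf_subset (H _ pX) => b [a Xa /R01 ab].
  by exists (set_val a).
have : uf_incl p (set_val @` X) by apply: uf_subset pX => a Xa; exists a.
by move=> /H /=; apply: uf_subset => b [_ [a Xa <-] /R01 ab]; exists a.
Qed.

Lemma uf_incl_onto (A1 : Type) (A0 : set A1) (u : Uf A1) :
  u A0 -> exists v : Uf A0, uf_incl v = u.
Proof.
move=> uA0; have [[x0 A0x0]|N] := pselect (exists x, A0 x); last first.
  by case: (@uf_set0 _ u); apply: uf_subset uA0 => x A0x; apply: N; exists x.
have [a0 _] := svalP A0x0.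
have /choice[r rP] : forall x, exists a : A0, A0 x -> set_val a = x.
  move=> x; have [A0x|nx] := pselect (A0 x).
    by have [a ax] := svalP A0x; exists a.
  by exists a0.
exists (umap r u); rewrite uf_incl_umap umap_comp -[RHS]umap_id.
by apply: umap_ae; apply: uf_subset uA0 => x A0x; exact: rP.
Qed.

Theorem theorem2p15 (A1 : Type) (A0 : set A1)
    (R0 : A0 -> A0 -> Prop) (R1 : A1 -> A1 -> Prop) :
  almost_bounded R0 -> almost_bounded R1 ->
  elementary R0 R1 (fun x : A0 => set_val x) ->
  elementary (ue R0) (ue R1) (fun u : Uf A0 => uf_incl u).
Proof.
move=> ab0 ab1 elem; apply: tarski_vaught.
- exact: uf_incl_inj.
- by move=> p p'; apply: ue_uf_incl; exact: rel_sval.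
move=> n phi e u satu.
have [uA0|uA0] := pselect (u A0).
  by have [v vE] := uf_incl_onto uA0; exists v; rewrite vE.
have [d _] : exists d : A1, True.
  apply: contrapT => N; apply: (@uf_set0 _ u).
  by apply: uf_subset (@uf_setT _ u) => d _; apply: N; exists d.
have [a0] := base_inhabited elem d.
have [L [f [f_edge edge_f f_inv]]] := edge_coloring_off_C ab1.
have [cs csP] := infinite_degree_list ab0 ab1 elem a0.
have [v vP] := exists_twin ab0 elem f_edge edge_f f_inv csP uA0 e.
by exists v; apply/vP.
Qed.
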